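(* Let $p\geqslant 11$ be a prime number with $p\equiv 1\bmod 5$, let $s$ be a primitive fifth root of unity in $\mathbb{Z}_p$, and let $$\hat{\mathbf{G}}_{s,s^4}=\langle a,b,c,d : a^p=b^p=c^5=d^2=[a,b]=(da)^2=(db)^2=1,\ cac^{-1}=a^s,\ cbc^{-1}=b^{s^4},\ dcd=a^{1-s}b^{1-s^4}c\rangle .$$ Up to duality, there are exactly two orientably-regular maps of Euler characteristic $-2p^2$ of type $\{5,10\}$ with orientation-preserving automorphism group isomorphic to $\hat{\mathbf{G}}_{s,s^4}$. They are reflexive.
   Context: A map $\mathscr{M}$ on a compact connected oriented surface $X$ is an embedding in $X$ of a finite connected graph whose complement is a disjoint union of topological discs, called faces. The Euler characteristic of the map is that of $X$. An automorphism of $\mathscr{M}$ is an incidence-preserving permutation of its edges, vertices and faces induced by a homeomorphism of $X$; $\mathrm{Aut}^+(\mathscr{M})$ is the group of those induced by orientation-preserving homeomorphisms. The map is orientably-regular if $\mathrm{Aut}^+(\mathscr{M})$ acts regularly on the set of arcs (edges endowed with a direction). Its type is $\{m,k\}$, where $k$ is the degree of each vertex and $m$ the size of each face. Equivalently, isomorphism classes of orientably-regular maps of type $\{m,k\}$ correspond to the finite index torsion-free normal subgroups $\Gamma$ of the triangle group $\Delta(2,m,k)=\langle y_1,y_2,y_3 : y_1^2=y_2^m=y_3^k=y_1y_2y_3=1\rangle$, with $\mathrm{Aut}^+(\mathscr{M})\cong\Delta(2,m,k)/\Gamma$. The dual map interchanges the roles of vertices and faces. An orientably-regular map is reflexive if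 it admits an orientation-reversing automorphism. Maps are counted up to orientation-preserving isomorphism. *)

(* Defs.v *)
From HB Require Import structures.
From mathcomp Require Import all_boot all_order all_algebra all_fingroup.

Set Implicit Arguments.
Unset Strict Implicit.
Unset Printing Implicit Defensive.

Import GRing.Theory.
Local Open Scope group_scope.

(* A map on a compact connected oriented surface, presented by its arcs        *)
(* (edges endowed with a direction), the elements of the type dart M:          *)
(*   opp M x == the same edge in the opposite direction;                       *)
(*   rot M x == the arc following x, for the positive orientation, around the  *)
(*              initial vertex of x.                                           *)
(* The group generated by rot and opp is transitive iff the embedded graph is  *)
(* connected; loops and multiple edges are allowed.  Every embedding with at   *)
(* least one edge arises in this way, uniquely up to isomorphism.  The only    *)
(* map left out is the single vertex on the sphere, of Euler characteristic 2. *)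
Record oriented_map := Map {
  dart : finType;
  rot : {perm dart};
  opp : {perm dart};
  oppK : involutive opp;
  opp_neq : forall x, opp x != x;
  map_connected : [transitive <<[set rot; opp]>>, on [set: dart] | 'P]
}.

(* Products in {perm T} compose from left to right: face_rot M maps x to       *)
(* (rot M)^-1 (opp M x), the next arc on the boundary walk of the face lying   *)
(* to the left of x.                                                           *)
Definition face_rot (M : oriented_map) : {perm dart M} := opp M * (rot M)^-1.

(* The orbits of rot, opp and face_rot are the vertices, edges and faces.      *)
Definition euler_char (M : oriented_map) : int :=
  (#|porbits (rot M)|%:Z - #|porbits (opp M)|%:Z + #|porbits (face_rot M)|%:Z)%R.

(* Type {m, k}: faces of size m, vertices of degree k.                         *)
Definition has_type (m k : nat) (M : oriented_map) : Prop :=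
  forall x : dart M, #|porbit (face_rot M) x| = m /\ #|porbit (rot M) x| = k.

Definition map_iso (M N : oriented_map) : Prop :=
  exists f : dart M -> dart N,
    [/\ bijective f, {morph f : x / rot M x >-> rot N x}
      & {morph f : x / opp M x >-> opp N x}].

(* Aut^+: the permutations of the arcs that commute with rot and opp. *)
Definition autp (M : oriented_map) : {group {perm dart M}} :=
  'C([set rot M; opp M])%G.

Definition orientably_regular (M : oriented_map) : Prop :=
  [transitive autp M, on [set: dart M] | 'P]
  /\ forall x : dart M, 'C_(autp M)[x | 'P] = 1.

(* An orientation-reversing automorphism inverts the rotation at vertices. *)
Definition reflexive_map (M : oriented_map) : Prop :=
  exists f : {perm dart M},
    (forall x, f (rot M x) = (rot M)^-1 (f x))
    /\ (forall x, f (opp M x) = opp M (f x)).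

Lemma dual_connected (M : oriented_map) :
  [transitive <<[set face_rot M; opp M]>>, on [set: dart M] | 'P].
Proof.
suff -> : <<[set face_rot M; opp M]>> = <<[set rot M; opp M]>>.
  exact: map_connected.
have R : rot M \in <<[set rot M; opp M]>> by rewrite mem_gen ?set21.
have O : opp M \in <<[set rot M; opp M]>> by rewrite mem_gen ?set22.
have F : face_rot M \in <<[set face_rot M; opp M]>> by rewrite mem_gen ?set21.
have O' : opp M \in <<[set face_rot M; opp M]>> by rewrite mem_gen ?set22.
have rotE : rot M = (face_rot M)^-1 * opp M by rewrite invMg invgK mulgKV.
have R' : rot M \in <<[set face_rot M; opp M]>>.
  by rewrite rotE groupM ?groupV.
have F' : face_rot M \in <<[set rot M; opp M]>> by rewrite groupM ?groupV.
by apply/eqP; rewrite eqEsubset !gen_subG !subUset !sub1set O O' R' F'.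
Qed.

(* The dual of the arc x crosses x from the face on its left to the face on    *)
(* its right, so the positive rotation around the dual vertices is face_rot.   *)
Definition dual (M : oriented_map) : oriented_map :=
  Map (@oppK M) (@opp_neq M) (dual_connected M).

Definition iso_up_to_dual (M N : oriented_map) : Prop :=
  map_iso M N \/ map_iso M (dual N).

(* Residues modulo p used as exponents stand for their representatives in      *)
(* [0, p).  The presented group is finite, so \isog Grp is isomorphism with    *)
(* it.                                                                         *)
Definition isog_Ghat (p : nat) (s : 'F_p) (gT : finGroupType) (G : {group gT}) : Prop :=
  G \isog Grp (a : b : c : d :
    (a ^+ p, b ^+ p, c ^+ 5, d ^+ 2, [~ a, b],
     (d * a) ^+ 2, (d * b) ^+ 2,
     c * a * c^-1 = a ^+ s,
     c * b * c^-1 = b ^+ (s ^+ 4)%R,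
     d * c * d = a ^+ (1 - s)%R * b ^+ (1 - s ^+ 4)%R * c)).

Definition Ghat_map (p : nat) (s : 'F_p) (m k : nat) (M : oriented_map) : Prop :=
  [/\ orientably_regular M, euler_char M = (- (2 * p ^ 2)%N%:Z)%R,
      has_type m k M & isog_Ghat s (autp M)].

(* Main.v *)
Require Import Defs.
From HB Require Import structures.
From mathcomp Require Import all_boot all_order all_algebra all_fingroup.
From mathcomp Require Import ring zify.
(* The rotation of a map takes precedence over the rotation of a list. *)
Import Defs.
Set Implicit Arguments.
Unset Strict Implicit.
Unset Printing Implicit Defensive.
Import GRing.Theory.

(** In the presented group, [d' = a^-1 b^-1 d] commutes with [c] and inverts
[a] and [b].  The group is therefore the extension of the plane [F_p^2], spanned
by [a] and [b], by the cyclic group of order 10 generated by [c] and [d'].  A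
generator of that cyclic group acts on the plane by [diag (t, t^-1)] for a
primitive tenth root of unity [t], and every primitive tenth root occurs.  So,
for any such [t], the group consists of the triples [(x, y, i)] in
[F_p * F_p * Z_10] under the product [amul t] ([isog_Ghat_affine]).

A regular map whose automorphism group is a group [G] can be drawn on [G] itself:
automorphisms are right multiplications, and [rot] and [opp] are the left
multiplications by two elements [r] and [l] generating [G] ([autp_chart]).  Here
[l] is an involution, hence a half turn [v |-> l0 - v] of the plane.  For
vertices of degree 10, the linear part of [r] is [diag (q, q^-1)] with [q] a
primitive tenth root of unity.  As [r] and [l] generate a transitive group, the
fixed points of [r] and of [l] differ in both coordinates.  Moving the origin
to the fixed point of [r] and rescaling the axes brings [l0] to [(1, 1)], so
only the choice of [q] remains: the map is [affine_map] at [q]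
([affine_classification]).

Exchanging the axes identifies the maps at [q] and at [q^-1], which leaves two
of the four primitive tenth roots, [t] and [t^3].  Composed with [i |-> - i], the
same exchange inverts [rot], so these maps are reflexive.  They differ because
[q + q^-1] is an invariant ([affine_iso_trace]): the words in [rot] and [opp]
that are translations of the plane satisfy a relation whose coefficient is the
trace of [diag (q, q^-1)].  Finally, maps of type {10, 5} are the duals of those
of type {5, 10}. *)

Local Open Scope group_scope.

(** * Orbits of a permutation and of two permutations *)

Section PermFacts.

Variable T : finType.
Implicit Types (s r l : {perm T}) (P : pred T) (x : T).

Lemma dvd_card_porbit s x n : (#|porbit s x| %| n) = (iter n s x == x).
Proof.
have iterM q y : y \in porbit s x -> iter (q * #|porbit s x|) s y = y.
  rewrite -eq_porbit_mem => /eqP <-; elim: q => // q IHq.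
  by rewrite mulSn iterD IHq iter_porbit.
apply/idP/eqP => [/dvdnP[q ->] | fix_x]; first exact/iterM/porbit_id.
rewrite /dvdn; set m := #|_|; have m_gt0 : 0 < m by rewrite lt0n card_porbit_neq0.
have: iter (n %% m) s x = x.
  by move: fix_x; rewrite {1}(divn_eq n m) addnC iterD iterM ?porbit_id.
have lt_m : n %% m < m by rewrite ltn_pmod.
have := uniq_traject_porbit s x; rewrite -/m => /(nth_uniq x) U.
move=> E; rewrite -(U (n %% m) 0) ?size_traject //.
by rewrite !nth_traject // E.
Qed.

Lemma card_porbits_const s n : 0 < n ->
  (forall x, #|porbit s x| = n) -> #|porbits s| = #|T| %/ n.
Proof.
move=> n_gt0 orb_n; have partT : partition (porbits s) [set: T].
  apply/and3P; split.
  - rewrite /cover; apply/eqP/setP => x; rewrite inE; apply/bigcupP.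
    by exists (porbit s x); [apply: imset_f | apply: porbit_id].
  - apply/trivIsetP => _ _ /imsetP[x _ ->] /imsetP[y _ ->] neq_xy.
    apply/pred0P => z /=; apply/andP => -[]; rewrite -!eq_porbit_mem.
    by move=> /eqP zx /eqP zy; rewrite -zx -zy eqxx in neq_xy.
  - by apply/imsetP => -[x _ E]; have := porbit_id s x; rewrite -E inE.
have := card_uniform_partition (n := n) _ partT.
rewrite cardsT => ->; first by rewrite mulnK.
by move=> _ /imsetP[x _ ->]; apply: orb_n.
Qed.

(** Transitivity as an induction principle.  It serves both to prove that a map
is connected and to propagate a property over all the darts of a given map. *)
Lemma trans_gen2P r l x0 :
  reflect (forall P, P x0 -> (forall x, P x -> P (r x)) ->
             (forall x, P x -> P (l x)) -> forall x, P x)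
          [transitive <<[set r; l]>>, on [set: T] | 'P].
Proof.
apply: (iffP idP) => [tr P Px0 Pr Pl x | ind].
  have /subsetP sub : <<[set r; l]>> \subset 'N([set z | P z] | 'P).
    rewrite gen_subG; apply/subsetP => g.
    by rewrite !inE => /pred2P[]->; apply/subsetP => z; rewrite !inE;
      [apply: Pr | apply: Pl].
  have [g /sub gN ->] := atransP2 tr (in_setT x0) (in_setT x).
  by have := astabsP gN x0; rewrite !inE Px0.
apply/imsetP; exists x0; rewrite ?inE //; apply/esym/setP => x; rewrite inE.
have closed g z : g \in [set r; l] ->
    z \in orbit 'P <<[set r; l]>> x0 -> g z \in orbit 'P <<[set r; l]>> x0.
  move=> gI /orbitP[h hG <-]; apply/orbitP; exists (h * g).
    exact: groupM hG (mem_gen gI).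
  by rewrite /= /aperm permM.
apply: (ind [in orbit 'P <<[set r; l]>> x0]) => [|z|z] /=; first exact: orbit_refl.
  by apply: closed; rewrite set21.
by apply: closed; rewrite set22.
Qed.

End PermFacts.

(** * Automorphisms, isomorphisms and duals of maps *)

Section Maps.

Implicit Types M N L : oriented_map.

Lemma map_ind M (P : pred (dart M)) x :
    P x -> (forall z, P z -> P (rot M z)) -> (forall z, P z -> P (opp M z)) ->
  forall y, P y.
Proof. exact: (trans_gen2P _ _ _ (map_connected M)). Qed.

Lemma autpP M (f : {perm dart M}) :
  reflect ((forall x, f (rot M x) = rot M (f x)) /\
           (forall x, f (opp M x) = opp M (f x))) (f \in autp M).
Proof.
apply: (iffP centP) => [cf | [fr fo] g].
  have com g : g \in [set rot M; opp M] -> forall x, f (g x) = g (f x).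
    by move=> /cf cfg x; rewrite -!permM cfg.
  by split=> x; apply: com; rewrite ?set21 ?set22.
by rewrite !inE => /pred2P[]->; apply/permP => x; rewrite !permM ?fr ?fo.
Qed.

(** Agreement at one dart propagates along [rot] and [opp].  So automorphisms act
freely, and a transitive group of them acts regularly. *)
Lemma autp_eq M (f g : {perm dart M}) x :
  f \in autp M -> g \in autp M -> f x = g x -> f = g.
Proof.
move=> /autpP[fr fo] /autpP[gr go] fgx.
apply/permP => y; apply/eqP; move: y.
apply: (map_ind (P := fun y => f y == g y) (x := x)) => [|z /eqP E|z /eqP E].
- exact/eqP.
- by rewrite fr gr E.
- by rewrite fo go E.
Qed.

Lemma orientably_regularI M (x0 : dart M) :
    (forall x, exists2 f, f \in autp M & f x0 = x) -> orientably_regular M.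
Proof.
move=> tr; split=> [|x].
  apply/imsetP; exists x0; rewrite ?inE //; apply/esym/setP => x.
  by rewrite inE; apply/orbitP; have [f fA fx] := tr x; exists f.
apply/trivgP/subsetP => f /setIP[fA /astab1P fx].
by apply/set1P; apply: (autp_eq (x := x) fA (group1 _)); rewrite perm1.
Qed.

Lemma map_iso_sym M N : map_iso M N -> map_iso N M.
Proof.
case=> f [[g fK gK] fr fo]; exists g; split; first by exists f.
  by move=> x; apply: (can_inj fK); rewrite fr !gK.
by move=> x; apply: (can_inj fK); rewrite fo !gK.
Qed.

Lemma map_iso_trans M N L : map_iso M N -> map_iso N L -> map_iso M L.
Proof.
case=> f [bf fr fo] [g [bg gr go]]; exists (g \o f).
by split=> [|x|x] /=; [apply: bij_comp | rewrite fr gr | rewrite fo go].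
Qed.

Lemma autp_dual M : autp (dual M) = autp M.
Proof.
apply/group_inj/setP => f.
apply/(@autpP (dual M))/(@autpP M) => /= -[fr fo]; split=> // x.
  have -> : rot M x = opp M ((face_rot M)^-1 x).
    by rewrite /face_rot invMg invgK permM -permM mulVg perm1.
  have -> : rot M (f x) = opp M ((face_rot M)^-1 (f x)).
    by rewrite /face_rot invMg invgK permM -permM mulVg perm1.
  rewrite fo; congr (opp M _); apply: (@perm_inj _ (face_rot M)).
  by rewrite -fr !permKV.
rewrite /face_rot !permM -fo; apply: (@perm_inj _ (rot M)).
by rewrite -fr !permKV.
Qed.

(** [face_rot] applies [opp] first and [rot^-1] second.  An isomorphism from
[dual M] to [N] carries [rot M] to the product of [opp N] and [(rot N)^-1] taken
in the other order; composing it with [opp] conjugates one order into the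
other. *)
Lemma map_iso_dual M N : map_iso (dual M) N -> map_iso M (dual N).
Proof.
case=> f [bf fr fo]; exists (f \o opp M); split=> [|x|x] /=; last first.
- by rewrite -fo.
- have -> : opp M (rot M x) = (face_rot M)^-1 (opp M (opp M x)).
    rewrite oppK /face_rot invMg invgK permM; apply: (canRL (permK _)).
    by rewrite oppK.
  apply: (@perm_inj _ (rot N)); rewrite -fr /= permKV [in RHS]/face_rot permM permKV.
  by rewrite -fo.
- apply: bij_comp bf _; exact: (inv_bij (@oppK M)).
Qed.

End Maps.

(** * The map attached to a primitive tenth root of unity *)

Local Close Scope group_scope.
Local Open Scope ring_scope.

Notation affine p := ('F_p * 'F_p * 'Z_10)%type.

Definition one_aff {p} : affine p := (0, 0, 0).

Lemma affine_fixpoint (F : fieldType) (c h : F) :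
  h != 1 -> c + h * (c / (1 - h)) = c / (1 - h).
Proof.
move=> h1; have nz : 1 - h != 0 by rewrite subr_eq0 eq_sym.
by apply: (mulIf nz); rewrite mulrDl -mulrA divfK // mulrBr mulr1 mulrC subrK.
Qed.

Section AffineMap.

Variables (p : nat) (t : 'F_p).
Hypotheses (p_pr : prime p) (t10 : 10.-primitive_root t).

Implicit Types (u v w z : affine p) (i j : 'Z_10).

(** The semidirect product of [F_p^2] by [Z_10], where [i] acts by
[diag (t ^+ i, t ^- i)]. *)
Definition amul u v : affine p :=
  (u.1.1 + t ^+ u.2 * v.1.1, u.1.2 + t ^- u.2 * v.1.2, u.2 + v.2).

Lemma root_neq0 : t != 0.
Proof. by rewrite (prim_root_eq0 t10). Qed.

Lemma root_exp_neq0 n : t ^+ n != 0.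
Proof. by rewrite expf_neq0 ?root_neq0. Qed.

Lemma root_expD i j : t ^+ (i + j)%R = t ^+ i * t ^+ j.
Proof. by rewrite -exprD -(prim_expr_mod t10 (i + j)). Qed.

Lemma root_exp5 : t ^+ 5 = -1.
Proof.
have: (t ^+ 5 - 1) * (t ^+ 5 + 1) == 0.
  by rewrite -subr_sqr -exprM (prim_expr_order t10) expr1n subrr.
rewrite mulf_eq0 subr_eq0 -(prim_order_dvd t10) addr_eq0 => /orP[//|/eqP //].
Qed.

Lemma two_neq0 : 2%:R != 0 :> 'F_p.
Proof. exact: (prim_root_dvd_eq0 t10 (m := 2)). Qed.

Lemma amulA : associative amul.
Proof.
move=> u v w; rewrite /amul /= !root_expD addrA invfM.
by rewrite !mulrDr !addrA !mulrA.
Qed.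

Lemma amulIl u : injective (amul u).
Proof.
move=> [[x y] i] [[x' y'] i'] /eqP; rewrite !xpair_eqE /=.
case/andP=> /andP[/eqP/addrI ex /eqP/addrI ey] /eqP/addrI ->.
rewrite (mulfI (root_exp_neq0 _) ex) (mulfI _ ey) //.
by rewrite invr_eq0 root_exp_neq0.
Qed.

Lemma amulIr u : injective (amul^~ u).
Proof.
move=> [[x y] i] [[x' y'] i'] /eqP; rewrite !xpair_eqE /=.
case/andP=> /andP[/eqP ex /eqP ey] /eqP/addIr E.
by move: ex ey; rewrite E => /addIr-> /addIr->.
Qed.

Lemma amul1 u : amul u one_aff = u.
Proof. by case: u => [[x y] i]; rewrite /amul /= !mulr0 !addr0. Qed.

(** Left multiplications, so that all right multiplications are automorphisms.
As [t ^+ 5 = -1], the second one is the half turn [v |-> (1, 1) - v]. *)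
Definition affine_rot := perm (@amulIl (0, 0, 1)).
Definition affine_opp := perm (@amulIl (1, 1, 5%:R)).

Lemma affine_rotE x y i : affine_rot (x, y, i) = (t * x, t^-1 * y, i + 1).
Proof. by rewrite permE /amul !add0r -[in RHS](expr1 t) [i + 1]addrC. Qed.

Lemma affine_oppE x y i : affine_opp (x, y, i) = (1 - x, 1 - y, i + 5%:R).
Proof.
rewrite permE /amul (_ : nat_of_ord (1, 1, 5%:R).2 = 5%N) //.
by rewrite root_exp5 invrN1 !mulN1r [i + _]addrC.
Qed.

Lemma iter_affine_rot n x y i :
  iter n affine_rot (x, y, i) = (t ^+ n * x, t ^- n * y, i + n%:R).
Proof.
elim: n => [|n IHn] /=; first by rewrite expr0 invr1 !mul1r addr0.
by rewrite IHn affine_rotE exprS invfM !mulrA -natr1 addrA.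
Qed.

Lemma affine_oppK : involutive affine_opp.
Proof.
by move=> [[x y] i]; rewrite !affine_oppE !subKr -addrA -natrD char_Zp // addr0.
Qed.

Lemma affine_opp_neq z : affine_opp z != z.
Proof.
case: z => [[x y] i]; rewrite affine_oppE xpair_eqE negb_and; apply/orP; right.
by rewrite -subr_eq0 addrC addKr.
Qed.

Lemma opp_rot5 x y i :
  affine_opp (iter 5 affine_rot (x, y, i)) = (x + 1, y + 1, i).
Proof.
rewrite iter_affine_rot affine_oppE root_exp5 invrN1 !mulN1r !opprK -addrA.
by rewrite -natrD char_Zp // addr0 ![1 + _]addrC.
Qed.

(** The product of [opp] and [rot ^ 5], both half turns of the plane, is the
translation by [(1, 1)].  Conjugating it by powers of [rot] gives the
translations by [(t ^+ n, t ^- n)]. *)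
Lemma shiftE n x y i : (n <= 10)%N ->
  iter n affine_rot (affine_opp (iter 5 affine_rot
    (iter (10 - n) affine_rot (x, y, i)))) = (x + t ^+ n, y + t ^- n, i).
Proof.
move=> le_n; rewrite iter_affine_rot opp_rot5 iter_affine_rot.
rewrite !mulrDr !mulr1 !mulrA -invfM -exprD subnKC // -addrA -natrD subnK //.
by rewrite (prim_expr_order t10) char_Zp // addr0 invr1 !mul1r.
Qed.

Lemma rootB_neq0 : t - t^-1 != 0.
Proof.
apply/eqP => /eqP; rewrite subr_eq0 -(inj_eq (mulfI root_neq0)) divff ?root_neq0 //.
by rewrite -expr2 -(prim_order_dvd t10).
Qed.

(** The translations by [(1, 1)] and [(t, t^-1)] span the plane because
[t != t^-1], and [rot] moves the third coordinate. *)
Lemma affine_connected :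
  [transitive <<[set affine_rot; affine_opp]>>, on [set: affine p] | 'P].
Proof.
apply/(trans_gen2P _ _ one_aff) => P P1 Pr Po [[x y] i].
have Pk n z : P z -> P (iter n affine_rot z).
  by move=> Pz; elim: n => //= n; apply: Pr.
have Ps m n x1 y1 i1 : (m <= 10)%N -> P (x1, y1, i1) ->
    P (x1 + t ^+ m *+ n, y1 + t ^- m *+ n, i1).
  move=> le_m Pz; elim: n => [|n IHn]; first by rewrite !addr0.
  by rewrite !mulrSr !addrA -shiftE //; apply/Pk/Po/Pk/Pk.
pose x0 : 'F_p := t ^- i * x; pose y0 : 'F_p := t ^+ i * y.
(* The solution of a + b * t = x0 and a + b * t^-1 = y0.  The point is then *)
(* reached from the origin by the two translations, followed by rot ^ i.    *)
pose b : 'F_p := (x0 - y0) / (t - t^-1); pose a : 'F_p := x0 - b * t.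
have natE (c v : 'F_p) : v *+ c = c * v by rewrite -mulr_natl natr_Zp.
have := Pk i _ (Ps 1%N b _ _ _ isT (Ps 0%N a _ _ _ isT P1)).
rewrite iter_affine_rot !natE expr0 invr1 !mulr1 !add0r natr_Zp subrK expr1.
suff -> : a + b * t^-1 = y0.
  by rewrite /x0 /y0 !mulrA divff ?mulVf ?root_exp_neq0 // !mul1r.
rewrite /a -addrA [- _ + _]addrC -mulrBr -[t^-1 - t]opprB mulrN.
by rewrite divfK ?rootB_neq0 // subKr.
Qed.

Definition affine_map : oriented_map :=
  Map affine_oppK affine_opp_neq affine_connected.

Lemma natZ10_eq0 n : (n%:R == 0 :> 'Z_10) = (10 %| n)%N.
Proof. by rewrite -val_eqE /= val_Zp_nat. Qed.

(** Left multiplication by an element with nontrivial linear part [q] has a fixed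
point in the plane, about which it acts linearly. *)
Lemma iter_amul n u z : u.2 != 0 -> (10 %| u.2 * n)%N -> iter n (amul u) z = z.
Proof.
case: u => [[u1 u2] k] /= nz_k k_n; set q := t ^+ k.
have q_n : q ^+ n = 1 by apply/eqP; rewrite -exprM -(prim_order_dvd t10).
have q1 : q != 1.
  by rewrite -(prim_order_dvd t10) /dvdn modn_small ?(ltn_ord k).
have qV1 : q^-1 != 1 by rewrite invr_eq1.
pose c1 := u1 / (1 - q); pose c2 := u2 / (1 - q^-1).
have iterE m : iter m (amul (u1, u2, k)) z =
  (c1 + q ^+ m * (z.1.1 - c1), c2 + q^-1 ^+ m * (z.1.2 - c2), k *+ m + z.2).
  elim: m => [|m IHm] /=.
    rewrite !expr0 !mul1r ![_ + (_ - _)]addrC !subrK mulr0n add0r.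
    by rewrite -!surjective_pairing.
  rewrite IHm /amul /= -/q ![_ * (_ + _)]mulrDr !addrA !affine_fixpoint //.
  by rewrite !mulrA -!exprS -addrA -mulrS addrA.
rewrite iterE exprVn q_n invr1 !mul1r ![_ + (_ - _)]addrC !subrK.
have -> : k *+ n = 0.
  by apply/eqP; rewrite -(natr_Zp k) -mulrnA natZ10_eq0.
by rewrite add0r -!surjective_pairing.
Qed.

Lemma affine_rot_order z : #|porbit affine_rot z| = 10%N.
Proof.
case: z => [[x y] i]; apply/eqP; rewrite eqn_dvd dvd_card_porbit.
set m := #|_|; have: iter m affine_rot (x, y, i) == (x, y, i).
  by rewrite -dvd_card_porbit.
rewrite !iter_affine_rot !xpair_eqE (prim_expr_order t10) invr1 !mul1r.
rewrite char_Zp // addr0 !eqxx /= -{2}[i]addr0 => /andP[_].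
by rewrite (inj_eq (addrI i)) natZ10_eq0.
Qed.

(** The face rotation is left multiplication by the quotient of the two defining
elements, whose linear part is [t ^+ 4]; hence faces have size 5. *)
Lemma affine_face_rotE z : (affine_opp * affine_rot^-1)%g z =
  amul (t^-1, t, 4%:R) z.
Proof.
rewrite permM; apply: (canLR (permK _)); rewrite !permE amulA.
congr (amul _ z); rewrite /amul !add0r (_ : nat_of_ord (0, 0, 1).2 = 1%N) //.
by rewrite expr1 divff ?mulVf ?root_neq0.
Qed.

Lemma affine_face_order z : #|porbit (face_rot affine_map) z| = 5%N.
Proof.
set m := #|_|; have m5 : (m %| 5)%N.
  rewrite dvd_card_porbit; apply/eqP.
  by rewrite (eq_iter affine_face_rotE) iter_amul.
case/primeP: (isT : prime 5) => _ /(_ _ m5) /pred2P[m1 | ->//].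
have : iter 1 (face_rot affine_map) z == z by rewrite -dvd_card_porbit -/m m1.
rewrite /= affine_face_rotE; case: {+}z => [[x y] i].
rewrite !xpair_eqE => /andP[_]; rewrite -{2}[i]add0r.
by rewrite (inj_eq (addIr i)) natZ10_eq0.
Qed.

Lemma affine_opp_order z : #|porbit affine_opp z| = 2%N.
Proof.
set m := #|_|; have m2 : (m %| 2)%N.
  by rewrite dvd_card_porbit /= affine_oppK.
case/primeP: (isT : prime 2) => _ /(_ _ m2) /pred2P[m1 | ->//].
have : iter 1 affine_opp z == z by rewrite -dvd_card_porbit -/m m1.
by rewrite (negPf (affine_opp_neq z)).
Qed.

Lemma euler_char_affine : euler_char affine_map = (- (2 * p ^ 2)%N%:Z)%R.
Proof.
rewrite /euler_char /= (card_porbits_const _ affine_rot_order) //.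
rewrite (card_porbits_const _ affine_opp_order) //.
rewrite (card_porbits_const _ affine_face_order) //.
rewrite !card_prod card_Fp // card_ord (_ : (Zp_trunc 10).+2 = 10%N) //; lia.
Qed.

Definition right_mul u := perm (@amulIr u).

Lemma right_mul_autp u : right_mul u \in autp affine_map.
Proof. by apply/autpP; split=> x; rewrite !permE amulA. Qed.

Lemma right_mul1 u : right_mul u one_aff = u.
Proof. by rewrite permE /amul /= !invr1 !mul1r !add0r -!surjective_pairing. Qed.

Lemma right_mulM u v : (right_mul u * right_mul v)%g = right_mul (amul u v).
Proof. by apply/permP => z; rewrite permM !permE amulA. Qed.

(** There are no automorphisms beyond right multiplications, since those already
act transitively and automorphisms act freely. *)
Lemma autp_affineE f : f \in autp affine_map -> f = right_mul (f one_aff).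
Proof.
move=> fA; apply: (autp_eq (M := affine_map) (x := one_aff) fA (right_mul_autp _)).
by rewrite right_mul1.
Qed.

Lemma affine_regular : orientably_regular affine_map.
Proof.
apply: (@orientably_regularI affine_map one_aff) => u.
by exists (right_mul u); [apply: right_mul_autp | apply: right_mul1].
Qed.

End AffineMap.

(** * Their automorphism group is the presented group *)

Local Close Scope ring_scope.
Local Open Scope group_scope.

(** The exponents are arbitrary numbers so that unfolding the presentation does not
also unfold the residues modulo [p] that are substituted for them. *)
Lemma Ghat_homP (p e1 e2 f1 f2 : nat) (gT : finGroupType) (G : {group gT}) :
  reflect (exists a b c d : gT, [/\ <<[set a; b; c; d]>> = G,
      [/\ a ^+ p = 1, b ^+ p = 1, c ^+ 5 = 1 & d ^+ 2 = 1],
      [/\ [~ a, b] = 1, (d * a) ^+ 2 = 1 & (d * b) ^+ 2 = 1]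
    & [/\ c * a * c^-1 = a ^+ e1, c * b * c^-1 = b ^+ e2
        & d * c * d = a ^+ f1 * b ^+ f2 * c]])
  (G \homg Grp (a : b : c : d :
    (a ^+ p, b ^+ p, c ^+ 5, d ^+ 2, [~ a, b], (d * a) ^+ 2, (d * b) ^+ 2,
     c * a * c^-1 = a ^+ e1, c * b * c^-1 = b ^+ e2,
     d * c * d = a ^+ f1 * b ^+ f2 * c))).
Proof.
have joinE (a b c d : gT) :
    <[a]> <*> <[b]> <*> <[c]> <*> <[d]> = <<[set a; b; c; d]>>.
  have joing_gen (A B : {set gT}) : <<A>> <*> <<B>> = <<A :|: B>>.
    by rewrite joing_idl joing_idr.
  by rewrite /cycle !joing_gen.
apply: (iffP existsP) => [[[[[a b] c] d]] | [a [b [c [d [genG]]]]]] /=.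
  rewrite !xpair_eqE joinE.
  case/and5P=> /eqP genG /eqP ? /eqP ? /eqP ?.
  case/and5P=> /eqP ? /eqP ? /eqP ? /eqP ? /and3P[/eqP ? /eqP ? /eqP ?].
  by exists a, b, c, d.
case=> ? ? ? ? [? ? ?] [? ? ?]; exists (a, b, c, d) => /=.
by rewrite !xpair_eqE joinE; do ![apply/andP; split]; apply/eqP.
Qed.

Section FpPowers.

Variables (p : nat) (gT : finGroupType) (a g : gT).
Hypotheses (p_pr : prime p) (ap1 : a ^+ p = 1).
Implicit Types x y h : 'F_p.

Lemma expg_FpD x y : a ^+ (x + y)%R = a ^+ x * a ^+ y.
Proof.
rewrite -expgD -(expg_mod (x + y) ap1); congr (a ^+ (_ %% _)).
exact: Fp_cast.
Qed.

Lemma expg_FpM x y : a ^+ (x * y)%R = a ^+ x ^+ y.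
Proof.
rewrite -expgM -(expg_mod (x * y) ap1); congr (a ^+ (_ %% _)).
exact: Fp_cast.
Qed.

Lemma expg_Fp1 : a ^+ (1%R : 'F_p) = a.
Proof.
rewrite -[RHS]expg1 -[in RHS](expg_mod 1 ap1); congr (a ^+ (_ %% _)).
exact: Fp_cast.
Qed.

Lemma expg_FpN x : a ^+ (- x)%R = (a ^+ x)^-1.
Proof.
apply: (mulgI (a ^+ x)); rewrite mulgV -expg_FpD.
by rewrite GRing.subrr.
Qed.

Lemma conjg_FpX h n : a ^ g = a ^+ h -> a ^ (g ^+ n) = a ^+ (h ^+ n)%R.
Proof.
move=> agh; elim: n => [|n IHn]; first by rewrite conjg1 expg_Fp1.
by rewrite expgSr conjgM IHn conjXg agh exprS expg_FpM.
Qed.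

End FpPowers.

Section Presentation.

Variables (p : nat) (s t : 'F_p).
Hypotheses (p_pr : prime p) (s5 : 5.-primitive_root%R s).
Hypothesis t10 : 10.-primitive_root%R t.

Local Notation R := (right_mul t).
Local Notation A := (autp (affine_map t10)).

(** The map [(x, y, i) |-> a ^+ x * b ^+ y * r ^+ i] is multiplicative, since the
hypotheses are the relations of the semidirect product. *)
Lemma homg_affine (gT : finGroupType) (H : {group gT}) (a b r : gT) :
    <<[set a; b; r]>> = H -> a ^+ p = 1 -> b ^+ p = 1 -> r ^+ 10 = 1 ->
    commute a b -> a ^ r^-1 = a ^+ t -> b ^ r^-1 = b ^+ (t^-1)%R ->
  H \homg A.
Proof.
move=> genH ap bp r10 cab ra rb.
pose F (u : affine p) := a ^+ u.1.1 * b ^+ u.1.2 * r ^+ u.2.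
have FM u v : F (amul t u v) = F u * F v.
  have rX : r ^+ (u.2 + v.2)%R = r ^+ u.2 * r ^+ v.2.
    by rewrite -expgD -[RHS](expg_mod _ r10).
  have raX : r ^+ u.2 * a ^+ v.1.1 = a ^+ (t ^+ u.2 * v.1.1)%R * r ^+ u.2.
    rewrite expg_FpM // -(conjg_FpX _ _ _ ra) // expgVn -conjXg.
    by rewrite conjgE invgK !mulgA mulgKV.
  have rbX : r ^+ u.2 * b ^+ v.1.2 = b ^+ (t ^- u.2 * v.1.2)%R * r ^+ u.2.
    rewrite -GRing.exprVn expg_FpM // -(conjg_FpX _ _ _ rb) // expgVn -conjXg.
    by rewrite conjgE invgK !mulgA mulgKV.
  have -> : F (amul t u v) = a ^+ (u.1.1 + t ^+ u.2 * v.1.1)%R *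
      b ^+ (u.1.2 + t ^- u.2 * v.1.2)%R * r ^+ (u.2 + v.2)%R by [].
  rewrite /F rX !expg_FpD //.
  rewrite !mulgA -[X in _ = X * _ * _]mulgA raX !mulgA.
  rewrite -[X in _ = X * _]mulgA rbX !mulgA.
  congr (_ * _ * _ * _); rewrite -[LHS]mulgA -[RHS]mulgA; congr (_ * _).
  exact: (commuteX2 _ _ cab).
pose f (g : {perm dart (affine_map t10)}) := F (g one_aff).
have fR u : f (R u) = F u by congr F; apply: right_mul1.
have fM : {in A &, {morph f : g h / g * h}}.
  move=> g h /autp_affineE -> /autp_affineE ->.
  by rewrite right_mulM // !fR FM.
apply/homgP; exists (Morphism fM).
rewrite morphimEdom -genH; apply/eqP; rewrite eqEsubset; apply/andP; split.
  apply/subsetP => _ /imsetP[g _ ->] /=; rewrite /f /F.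
  by rewrite !groupM ?groupX ?mem_gen // !inE eqxx ?orbT.
have fA (u : affine p) : F u \in [set f g | g in A].
  by rewrite -fR imset_f ?right_mul_autp.
have -> : [set f g | g in A] = (Morphism fM @* A)%G by rewrite /= morphimEdom.
rewrite gen_subG; apply/subsetP => g; rewrite !inE -orbA => gE.
rewrite /= morphimEdom.
have [u ->] : exists u, g = F u.
  case/or3P: gE => /eqP ->.
  - by exists (1, 0, 0)%R; rewrite -{1}(expg_Fp1 p_pr ap) -[LHS]mulg1 -[LHS]mulg1.
  - by exists (0, 1, 0)%R; rewrite -{1}(expg_Fp1 p_pr bp) -[LHS]mul1g -[LHS]mulg1.
  - by exists (0, 0, 1)%R; rewrite -[LHS]mul1g -[LHS]mul1g mulgA.
exact: fA.
Qed.

(** The next two lemmas allow the exponent of the linear action to be read either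
from [s] or from [t]: [- t] is a fifth root of unity and [s] a tenth one. *)
Lemma prim5_of_prim10 : exists e, t = (- s ^+ e)%R.
Proof.
have /(prim_rootP s5)[e te] : ((- t) ^+ 5 = 1)%R.
  by rewrite exprNn (root_exp5 t10) -signr_odd /= mulrNN mulr1.
by exists e; rewrite -te GRing.opprK.
Qed.

Lemma prim10_of_prim5 : exists j : 'Z_10, s = (t ^+ j)%R.
Proof.
have /(prim_rootP t10)[j sj] : (s ^+ 10 = 1)%R; last by exists j.
by rewrite (exprM s 5 2) (prim_expr_order s5) expr1n.
Qed.

Lemma amul_trans x y x' y' (i : 'Z_10) :
  amul t (x, y, 0)%R (x', y', i) = (x + x', y + y', i)%R.
Proof. by rewrite /amul expr0 invr1 !mul1r add0r. Qed.

Lemma amul_rot i j x y :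
  amul t (0, 0, i)%R (x, y, j) = (t ^+ i * x, t ^- i * y, i + j)%R.
Proof. by rewrite /amul !add0r. Qed.

Lemma amul_half x y x' y' (i : 'Z_10) :
  amul t (x, y, 5%:R)%R (x', y', i) = (x - x', y - y', 5%:R + i)%R.
Proof.
rewrite /amul (_ : nat_of_ord (x, y, 5%:R)%R.2 = 5) // (root_exp5 t10).
by rewrite invrN1 !mulN1r.
Qed.

Lemma right_mul_one : R one_aff = 1.
Proof. by apply/permP => u; rewrite permE perm1 amul1. Qed.

Lemma right_mul_transX x y n : R (x, y, 0%R) ^+ n = R (x *+ n, y *+ n, 0)%R.
Proof.
elim: n => [|n IHn]; first by rewrite expg0 -right_mul_one.
rewrite expgS IHn right_mulM // /amul /= expr0 invr1 !mul1r -!mulrS.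
by rewrite addr0.
Qed.

Lemma right_mul_rotX i n : R (0, 0, i)%R ^+ n = R (0, 0, i *+ n)%R.
Proof.
elim: n => [|n IHn]; first by rewrite expg0 -right_mul_one.
by rewrite expgS IHn right_mulM // /amul /= !mulr0 !addr0 -mulrS.
Qed.

Lemma right_mul_half x y : R (x, y, 5%:R)%R ^+ 2 = 1.
Proof.
rewrite expgS expg1 right_mulM // -right_mul_one; congr (R _).
by rewrite amul_half !subrr -natrD char_Zp.
Qed.

Lemma exp5_prim10 (j : 'Z_10) : s = (t ^+ j)%R -> (10 %| j * 5)%N.
Proof.
by move=> sj; rewrite (prim_order_dvd t10) exprM -sj (prim_expr_order s5).
Qed.

(** Here [a] and [b] are the unit translations, [c] is the linear map
[diag (s, s^-1)], and [d] is the half turn [v |-> (1, 1) - v].  Conjugating [c] by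
[d] moves its fixed point from the origin to [(1, 1)], which accounts for the
last relation. *)
Lemma affine_homg_Ghat :
  A \homg Grp (a : b : c : d :
    (a ^+ p, b ^+ p, c ^+ 5, d ^+ 2, [~ a, b], (d * a) ^+ 2, (d * b) ^+ 2,
     c * a * c^-1 = a ^+ s, c * b * c^-1 = b ^+ (s ^+ 4)%R,
     d * c * d = a ^+ (1 - s)%R * b ^+ (1 - s ^+ 4)%R * c)).
Proof.
have [j sj] := prim10_of_prim5; have [e te] := prim5_of_prim10.
have s4 : (s ^+ 4 = t ^- j)%R.
  have s_neq0 : (s != 0)%R by rewrite (prim_root_eq0 s5).
  apply: (mulfI s_neq0); rewrite -exprS (prim_expr_order s5) sj.
  by rewrite divff ?root_exp_neq0.
apply/Ghat_homP; pose a := R (1, 0, 0)%R; pose b := R (0, 1, 0)%R.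
pose c := R (0, 0, j)%R; pose d := R (1, 1, 5%:R)%R.
have aX (x : 'F_p) : a ^+ x = R (x, 0, 0)%R.
  by rewrite right_mul_transX natr_Zp mul0rn.
have bX (x : 'F_p) : b ^+ x = R (0, x, 0)%R.
  by rewrite right_mul_transX natr_Zp mul0rn.
have abX (x y : 'F_p) : a ^+ x * b ^+ y = R (x, y, 0)%R.
  by rewrite aX bX right_mulM // amul_trans addr0 add0r.
exists a, b, c, d; split.
- have genI g : g \in [set a; b; c; d] -> g \in <<[set a; b; c; d]>>.
    exact: mem_gen.
  have genX (x y : 'F_p) : R (x, y, 0)%R \in <<[set a; b; c; d]>>.
    by rewrite -abX groupM ?groupX ?genI // !inE eqxx ?orbT.
  have genr : R (0, 0, 1)%R \in <<[set a; b; c; d]>>.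
    (* The translation by (-1, -1) turns d into the half turn about the origin, *)
    (* and t = - s ^+ e.                                                        *)
    have -> : R (0, 0, 1)%R = c ^+ e * (R (- 1, - 1, 0)%R * d).
      rewrite right_mul_rotX !right_mulM //; congr (R _).
      rewrite amul_trans !addNr amul_rot !mulr0; congr (_, _, _); apply: ord_inj.
      rewrite -[in LHS](mulr1n 1%R) -(natr_Zp j) -mulrnA -natrD !val_Zp_nat //.
      apply/eqP; rewrite -(eq_prim_root_expr t10) exprD exprM -sj (root_exp5 t10).
      by rewrite mulrN1 expr1 te.
    by rewrite !groupM ?groupX ?genX // genI // !inE eqxx ?orbT.
  apply/eqP; rewrite eqEsubset gen_subG; apply/andP; split; apply/subsetP => g.
    rewrite !inE -!orbA => /or4P[]/eqP->; exact: right_mul_autp.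
  move=> /autp_affineE ->; case: (g one_aff) => [[x y] i].
  have -> : R (x, y, i) = R (x, y, 0)%R * R (0, 0, 1)%R ^+ i.
    by rewrite right_mul_rotX natr_Zp right_mulM // amul_trans !addr0.
  by rewrite groupM ?groupX.
- split.
  + by rewrite right_mul_transX -right_mul_one pchar_Fp_0 // mul0rn.
  + by rewrite right_mul_transX -right_mul_one pchar_Fp_0 // mul0rn.
  + rewrite right_mul_rotX -right_mul_one; congr (R (_, _, _)).
    apply/eqP; rewrite -(natr_Zp j) -mulrnA natZ10_eq0.
    exact: exp5_prim10.
  + exact: right_mul_half.
- split.
  + apply/eqP/commgP; rewrite /commute !right_mulM //; congr (R _).
    by rewrite !amul_trans !addr0 !add0r.
  + rewrite right_mulM // /amul addr0; exact: right_mul_half.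
  + rewrite right_mulM // /amul addr0; exact: right_mul_half.
- split.
  + rewrite aX; apply: (canLR (mulgK _)); rewrite !right_mulM //; congr (R _).
    by rewrite amul_trans amul_rot -sj !mulr0 mulr1 !addr0.
  + rewrite bX; apply: (canLR (mulgK _)); rewrite !right_mulM //; congr (R _).
    by rewrite amul_trans amul_rot -s4 !mulr0 mulr1 !addr0.
  + rewrite abX !right_mulM // -amulA // amul_rot !mulr1 -s4 -sj amul_half.
    by rewrite amul_trans !addr0 addrCA -natrD char_Zp // addr0.
Qed.

(** The half turn about the fixed point of [c] is [d' = a^-1 b^-1 d].  It commutes
with [c], so [r = c ^+ e * d'] has order dividing 10 and acts on [a] and [b] as
[- s ^+ e = t] and its inverse.  Both [c] and [d'] are powers of [r]. *)
Lemma Ghat_homg_affine (gT : finGroupType) (H : {group gT}) :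
  H \homg Grp (a : b : c : d :
    (a ^+ p, b ^+ p, c ^+ 5, d ^+ 2, [~ a, b], (d * a) ^+ 2, (d * b) ^+ 2,
     c * a * c^-1 = a ^+ s, c * b * c^-1 = b ^+ (s ^+ 4)%R,
     d * c * d = a ^+ (1 - s)%R * b ^+ (1 - s ^+ 4)%R * c)) ->
  H \homg A.
Proof.
have [j sj] := prim10_of_prim5; have [e te] := prim5_of_prim10.
have s_neq0 : (s != 0)%R by rewrite (prim_root_eq0 s5).
have tVe : (t^-1 = - (s ^+ 4) ^+ e)%R.
  have t_neq0 := root_neq0 t10; apply: (mulfI t_neq0).
  rewrite divff // te mulrNN -exprM mulnC exprM -exprS -exprM mulnC exprM.
  by rewrite (prim_expr_order s5) expr1n.
case/Ghat_homP=> a [b [c [d [genH [ap bp c5 d2] [/eqP/commgP cab da db]]]]].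
case=> ca cb dcd; pose d' := a^-1 * b^-1 * d.
have sqV (x : gT) : x ^+ 2 = 1 -> x^-1 = x.
  by move=> x2; apply: (mulgI x); rewrite mulgV -x2 expgS expg1.
have dxE (x : gT) : (d * x) ^+ 2 = 1 -> d * x = x^-1 * d.
  by move=> dx; apply: etrans (esym (sqV _ dx)) _; rewrite invMg (sqV d).
have dxV (x : gT) : (d * x) ^+ 2 = 1 -> d * x^-1 = x * d.
  by move=> dx; apply: (mulIg x); rewrite mulgKV -mulgA dxE // mulKVg.
have d'x (x : gT) : commute x a -> commute x b -> (d * x) ^+ 2 = 1 ->
    x ^ d' = x^-1.
  move=> xa xb dx; have xab : commute x (a^-1 * b^-1).
    by apply: commuteM; apply: commuteV.
  rewrite conjgE; apply: (canLR (mulKg _)).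
  by rewrite /d' mulgA xab -mulgA -dxV // mulgA.
have d'2 : d' ^+ 2 = 1.
  have dw : d * (a^-1 * b^-1) = a * b * d.
    by rewrite mulgA dxV // -mulgA dxV // mulgA.
  rewrite expgS expg1 /d' -mulgA [d * _]mulgA dw -[a * b * d * d]mulgA.
  by rewrite -{2}(sqV d d2) mulgV mulg1 -invMg cab mulVg.
have cd' : commute c d'.
  have cJ (x : gT) (h : 'F_p) : x ^+ p = 1 -> c * x * c^-1 = x ^+ h ->
      c * x^-1 = x ^+ (- h)%R * c.
    move=> xp cx; apply: (canRL (mulgKV _)); rewrite expg_FpN // -cx.
    by rewrite !invMg invgK mulgA.
  have dX (x : gT) n : (d * x) ^+ 2 = 1 -> d * x ^+ n = x ^- n * d.
    move=> dx; elim: n => [|n IHn]; first by rewrite expg0 invg1 mulg1 mul1g.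
    by rewrite expgS mulgA dxE // -mulgA IHn mulgA -invMg -expgSr -expgS.
  have cdE : c * d = a ^+ (s - 1)%R * b ^+ (s ^+ 4 - 1)%R * d * c.
    apply: (mulgI d); rewrite mulgA dcd -[(s ^+ 4 - 1)%R]opprB -[(s - 1)%R]opprB.
    rewrite !expg_FpN // -{1}(sqV d d2); apply: (canRL (mulKg _)).
    by rewrite !mulgA dX // -[_ * d * _]mulgA dX // mulgA.
  rewrite /commute /d' !mulgA (cJ a s) // -[_ * c * b^-1]mulgA.
  rewrite (cJ b (s ^+ 4)%R) // !mulgA -[_ * c * d]mulgA cdE !mulgA.
  congr (_ * _ * _).
  rewrite -[_ * _ * a ^+ _]mulgA (commuteX2 _ _ (commute_sym cab) : _ * _ = _) mulgA.
  rewrite -expg_FpD // -mulgA -expg_FpD //.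
  have -> : (- s + (s - 1) = - 1)%R by rewrite addKr.
  have -> : (- s ^+ 4 + (s ^+ 4 - 1) = - 1)%R by rewrite addKr.
  by rewrite !expg_FpN // !expg_Fp1.
pose r := c ^+ e * d'.
have d'V := sqV d' d'2.
have cJX (x : gT) (h : 'F_p) n : x ^+ p = 1 -> c * x * c^-1 = x ^+ h ->
    (x^-1) ^ (c ^- n) = x ^+ (- h ^+ n)%R.
  move=> xp cx; rewrite conjVg -expgVn (conjg_FpX _ _ (h := h)) // ?expg_FpN //.
  by rewrite conjgE invgK mulgA.
have rV : r^-1 = d' * c ^- e by rewrite invMg d'V.
have rX n : r ^+ n = c ^+ (e * n) * d' ^+ n.
  by rewrite expgMn ?expgM //; apply/commute_sym/commuteX/commute_sym.
have d'r : r ^+ 5 = d'.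
  by rewrite rX mulnC expgM c5 expg1n mul1g -[LHS](expg_mod 5 d'2).
have r10 : r ^+ 10 = 1 by rewrite (expgM r 5 2) d'r.
have cr : r ^+ j = c.
  (* As j is even, d' drops out, and s ^+ (e * j) = (- t) ^+ j = t ^+ j = s. *)
  have j_even : ~~ odd j by have := exp5_prim10 sj; lia.
  rewrite rX -(expg_mod j d'2) modn2 (negPf j_even) mulg1.
  rewrite -(expg_mod _ c5) (_ : e * j %% 5 = 1 %% 5) //; apply/eqP.
  rewrite -(eq_prim_root_expr s5) exprM -[(s ^+ e)%R]opprK -te exprNn.
  by rewrite -signr_odd (negPf j_even) mul1r -sj.
apply: (@homg_affine _ H a b r) => //.
- rewrite -genH; apply/eqP; rewrite eqEsubset !gen_subG.
  apply/andP; split; apply/subsetP => g; rewrite !inE -!orbA.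
    have genI h : h \in [set a; b; c; d] -> h \in <<[set a; b; c; d]>>.
      exact: mem_gen.
    case/or3P=> /eqP->; rewrite ?groupM ?groupX ?groupV ?genI //;
      by rewrite !inE eqxx ?orbT.
  have genI h : h \in [set a; b; r] -> h \in <<[set a; b; r]>>.
    exact: mem_gen.
  have [aG bG rG] : [/\ a \in <<[set a; b; r]>>, b \in <<[set a; b; r]>>
                     & r \in <<[set a; b; r]>>].
    by split; apply: genI; rewrite !inE eqxx ?orbT.
  case/or4P=> /eqP-> //; first by rewrite -cr groupX.
  have -> : d = b * a * d' by rewrite /d' -cab mulgA -invMg -cab mulgV mul1g.
  by apply: groupM; [apply: groupM | rewrite -d'r groupX].
- by rewrite rV conjgM d'x // (cJX _ s) // te.
- by rewrite rV conjgM d'x // ?(cJX _ (s ^+ 4)%R) // tVe.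
Qed.

Lemma isog_Ghat_affine : isog_Ghat s A.
Proof.
apply: intro_isoGrp; first exact: affine_homg_Ghat.
by move=> gT H; apply: Ghat_homg_affine.
Qed.

End Presentation.

(** * Isomorphisms between these maps *)

Local Close Scope group_scope.
Local Open Scope ring_scope.

Section Isomorphisms.

Variables (p : nat) (t : 'F_p).
Hypotheses (p_pr : prime p) (t10 : 10.-primitive_root t).

Lemma affine_iso_inv (tV10 : 10.-primitive_root t^-1) :
  map_iso (affine_map t10) (affine_map tV10).
Proof.
exists (fun z : affine p => (z.1.2, z.1.1, z.2)); split.
- by exists (fun z : affine p => (z.1.2, z.1.1, z.2)) => -[[]].
- by move=> [[x y] i]; rewrite /= !affine_rotE invrK.
- by move=> [[x y] i]; rewrite /= !affine_oppE.
Qed.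

(** Exchanging the axes inverts the linear part of [rot], and negating the third
coordinate inverts its action there. *)
Lemma affine_reflexive : reflexive_map (affine_map t10).
Proof.
pose f (z : affine p) : affine p := (z.1.2, z.1.1, - z.2).
have fK : involutive f by move=> [[x y] i]; rewrite /f /= opprK.
have fE z : perm (inv_inj fK) z = f z by rewrite permE.
exists (perm (inv_inj fK)); split=> z; rewrite !fE; case: z => [[x y] i].
  apply: (canRL (permK (affine_rot t10))); rewrite /= affine_rotE.
  rewrite /f /= affine_rotE.
  by rewrite !mulrA divff ?mulVf ?root_neq0 // !mul1r opprD addrNK.
rewrite /= affine_oppE /f /= affine_oppE opprD.
by rewrite (_ : - 5%:R = 5%:R :> 'Z_10) //; apply: val_inj.
Qed.

Variables (t' : 'F_p) (t10' : 10.-primitive_root t').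

(** Let [T] be the translation [opp * rot ^ 5], and [T1], [T2] its conjugates by
[rot] and [rot ^ 2].  As [diag (t, t^-1)] is annihilated by
['X^2 - (t + t^-1) * 'X + 1], one has [T2 * T = T1 ^ n] for [n] representing
[t + t^-1].  An isomorphism carries this relation to the map at [t'], where it
says that [t'^2 + 1 = n * t']. *)
Lemma affine_iso_trace :
  map_iso (affine_map t10) (affine_map t10') -> t + t^-1 = t' + t'^-1.
Proof.
case=> f [bij_f f_rot f_opp].
pose word M m (z : dart M) :=
  iter m (rot M) (opp M (iter 5 (rot M) (iter (10 - m) (rot M) z))).
have f_iter n z : f (iter n (rot _) z) = iter n (rot _) (f z).
  by elim: n => //= n IHn; rewrite f_rot IHn.
have f_word m z : f (word _ m z) = word _ m (f z).
  by rewrite /word f_iter f_opp !f_iter.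
pose n := nat_of_ord (t + t^-1)%R.
have wordE (u : 'F_p) (u10 : 10.-primitive_root u) m x y i : (m <= 10)%N ->
  word (affine_map u10) m (x, y, i) = (x + u ^+ m, y + u ^- m, i).
  by move=> le_m; apply: shiftE.
have iter_wordE (u : 'F_p) (u10 : 10.-primitive_root u) k x y i :
    iter k (word (affine_map u10) 1%N) (x, y, i) =
    (x + k%:R * u, y + k%:R * u^-1, i).
  elim: k => [|k IHk]; first by rewrite !mul0r !addr0.
  by rewrite iterS IHk wordE // -natr1 !mulrDl !mul1r !addrA.
have nE : n%:R = t + t^-1 :> 'F_p by rewrite /n natr_Zp.
have relation z : word (affine_map t10) 2 (word _ 0%N z) = iter n (word _ 1%N) z.
  case: z => [[x y] i]; rewrite iter_wordE !wordE // nE !mulrDl.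
  rewrite mulVf ?divff ?root_neq0 // expr0 invr1 -expr2 -invfM -expr2 -!addrA.
  by rewrite [1 + t ^+ 2]addrC.
have [g fK gK] := bij_f.
have f_words k z : f (iter k (word _ 1%N) z) = iter k (word _ 1%N) (f z).
  by elim: k => //= k IHk; rewrite f_word IHk.
have := congr1 f (relation (g one_aff)).
rewrite !f_word f_words gK iter_wordE !wordE // nE !add0r expr0.
case/eqP; rewrite !xpair_eqE => /andP[/andP[/eqP + _] _].
move=> E; apply: (mulIf (root_neq0 t10')).
by rewrite -E mulrDl mulVf ?root_neq0 // addrC expr2.
Qed.

End Isomorphisms.

Lemma isoGrp_isog (gT hT : finGroupType) (G : {group gT}) (H : {group hT}) P :
  (G \isog Grp P -> H \isog Grp P -> G \isog H)%g.
Proof. by move=> isoG isoH; rewrite isogEhom isoG isoH -isoG -isoH !homg_refl. Qed.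

(** * Classification of the regular maps with this group *)

Section Classification.

Variables (p : nat) (s t : 'F_p).
Hypotheses (p_pr : prime p) (s5 : 5.-primitive_root s).
Hypothesis t10 : 10.-primitive_root t.

Lemma coprime10E k : (k < 10)%N -> k != 0%N -> ~~ (10 %| k * 5)%N ->
  ~~ (10 %| k * 2)%N -> coprime k 10.
Proof. by do 10![case: k => [|k] //]. Qed.

Lemma leq_card_surj (T S : finType) (e : T -> S) :
  (forall x, exists u, e u = x) -> (#|S| <= #|T|)%N.
Proof.
move=> surj_e; apply: leq_trans (leq_image_card e predT); apply: subset_leq_card.
by apply/subsetP => x _; have [u <-] := surj_e x; apply: image_f.
Qed.

(** If [phi] is an isomorphism onto [autp M] and [x0] a dart, then
[u |-> phi (right_mul t u) x0] identifies triples with darts.  As [rot M] and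
[opp M] commute with automorphisms, they are left multiplications by the triples
of [rot M x0] and [opp M x0]. *)
Lemma autp_chart (M : oriented_map) :
    orientably_regular M -> (autp (affine_map t10) \isog autp M)%g ->
  exists (e : affine p -> dart M) (r l : affine p), [/\ bijective e,
    forall u, rot M (e u) = e (amul t r u) &
    forall u, opp M (e u) = e (amul t l u)].
Proof.
case=> tr _ /isogP[phi inj_phi phiA].
have /imsetP[x0 _ _] := map_connected M.
pose e u := phi (right_mul t u) x0.
have RA u : right_mul t u \in autp (affine_map t10) by apply: right_mul_autp.
have phiR u : phi (right_mul t u) \in autp M by rewrite -phiA mem_morphim.
have surj_e x : exists u, e u = x.
  have [g gA ->] := atransP2 tr (in_setT x0) (in_setT x).
  move: gA; rewrite -phiA => /morphimP[h _ hA ->].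
  by exists (h one_aff); rewrite /e -autp_affineE.
have inj_e : injective e.
  move=> u v /(autp_eq (phiR u) (phiR v)) E.
  have /permP/(_ one_aff) := injmP inj_phi _ _ (RA u) (RA v) E.
  by rewrite !right_mul1.
have eM u v : phi (right_mul t v) (e u) = e (amul t u v).
  by rewrite /e -right_mulM // morphM ?RA // permM.
have [[r er] [l el]] := (surj_e (rot M x0), surj_e (opp M x0)).
exists e, r, l; split=> [|u|u].
- exact: inj_card_bij inj_e (leq_card_surj surj_e).
- by have /autpP[phi_rot _] := phiR u; rewrite -eM er phi_rot.
- by have /autpP[_ phi_opp] := phiR u; rewrite -eM el phi_opp.
Qed.

(** The linear part of an involution is [1] or [-1], and no translation is an
involution because [p] is odd. *)
Lemma half_turn_index (l : affine p) : amul t l l = one_aff -> l != one_aff ->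
  l.2 = 5%:R.
Proof.
case: l => [[x y] i] /eqP; rewrite !xpair_eqE /= => /andP[/andP[ex ey] ei] l1.
have i5 : (10 %| i * 2)%N by rewrite -natZ10_eq0 mulrnA natr_Zp mulr2n.
have [i0 | i_neq0] := eqVneq i 0; last first.
  apply: ord_inj; move: i_neq0 i5; rewrite -(inj_eq (@ord_inj _)).
  by case: (i) => [[|[|[|[|[|[|[|[|[|[|]]]]]]]]]]].
case/negP: l1; rewrite [in i == 0]i0 eqxx andbT; move: ex ey.
rewrite i0 expr0 invr1 !mul1r -!mulr2n -(mulr_natr x) -(mulr_natr y) !mulf_eq0.
by rewrite (negPf (two_neq0 t10)) !orbF => -> ->.
Qed.

(** A translation has order dividing [p], which is not a multiple of 10; a nonzero
index that is even or equal to 5 gives an element of order at most 5. *)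
Lemma rot_index (r : affine p) :
    (forall n, (iter n (amul t r) one_aff == one_aff) = (10 %| n)%N) ->
  coprime r.2 10.
Proof.
move=> r_order; have [r0 | r_neq0] := eqVneq r.2 0.
  have iterE n : iter n (amul t r) one_aff = (r.1.1 *+ n, r.1.2 *+ n, 0).
    elim: n => // n IHn; rewrite iterS IHn /amul r0 expr0 invr1 !mul1r !addr0.
    by rewrite -!mulrS.
  have /esym := r_order p; rewrite iterE -(mulr_natr r.1.1) -(mulr_natr r.1.2)
    pchar_Fp_0 // !mulr0 eqxx.
  move=> p10; have : (2 %| p)%N by apply: dvdn_trans p10.
  rewrite dvdn_prime2 // => /eqP p2; have := two_neq0 t10.
  by rewrite {1}p2 pchar_Fp_0 // eqxx.
apply: coprime10E; first exact: (ltn_ord r.2).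
- exact: r_neq0.
- by apply/negP => r5; have := r_order 5; rewrite iter_amul ?eqxx.
- by apply/negP => r2; have := r_order 2; rewrite iter_amul ?eqxx.
Qed.

(** If [rot] and [opp] fixed the same value [b] of a coordinate, the darts where the
coordinate is [b] would form a proper subset stable under both. *)
Lemma no_common_fixpoint (M : oriented_map) (e : affine p -> dart M)
    (r l : affine p) (coord : affine p -> 'F_p) (h u v b : 'F_p) :
    bijective e ->
    (forall z, rot M (e z) = e (amul t r z)) ->
    (forall z, opp M (e z) = e (amul t l z)) ->
    (forall z, coord (amul t r z) = u + h * coord z) ->
    (forall z, coord (amul t l z) = v - coord z) ->
    (forall c, exists z, coord z = c) ->
  u + h * b = b -> v - b *+ 2 != 0.
Proof.
move=> [g eK gK] e_rot e_opp c_r c_l c_surj fix_b; apply/eqP => vb.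
have [z0 z0b] := c_surj b; have [z1 z1b] := c_surj (b + 1).
have: coord (g (e z1)) == b.
  apply: (map_ind (P := fun x => coord (g x) == b) (x := e z0)) => [|z|z].
  - by rewrite eK z0b.
  - by rewrite -{2}(gK z) e_rot eK c_r => /eqP->; rewrite fix_b.
  rewrite -{2}(gK z) e_opp eK c_l => /eqP->.
  by rewrite subr_eq -mulr2n -subr_eq0 vb.
by rewrite eK z1b -{2}[b]addr0 (inj_eq (addrI b)) oner_eq0.
Qed.

(** In the coordinates of [autp_chart], [(b1, b2)] is the fixed point of [r], and the
vector from it to its image under [l] is [(l1 - 2 b1, l2 - 2 b2)].  The affine
change of coordinates [f] sends the origin to that fixed point and the vector
[(1, 1)] to this vector. *)
Lemma affine_classification (M : oriented_map) :
    orientably_regular M -> (forall x, #|porbit (rot M) x| = 10%N) ->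
    isog_Ghat s (autp M) ->
  exists (t' : 'F_p) (t10' : 10.-primitive_root t'), map_iso M (affine_map t10').
Proof.
move=> regM rot10 isoM.
have isoA := isoGrp_isog (isog_Ghat_affine p_pr s5 t10) isoM.
have [e [r [l [bij_e e_rot e_opp]]]] := autp_chart regM isoA.
have inj_e := bij_inj bij_e.
have e_iter n z : iter n (rot M) (e z) = e (iter n (amul t r) z).
  by elim: n => //= n ->; rewrite e_rot.
have co_r : coprime r.2 10.
  apply: rot_index => n.
  by rewrite -(inj_eq inj_e) -e_iter -dvd_card_porbit rot10.
have l5 : l.2 = 5%:R.
  apply: half_turn_index.
    by apply: inj_e; rewrite -{2}[l](amul1 t) // -!e_opp oppK.
  apply: contraNneq (opp_neq (e one_aff)) => l1.
  by rewrite e_opp amul1 l1.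
case: r l l5 e_rot e_opp e_iter co_r => [[r1 r2] k] [[l1 l2] i] /= ->.
move=> e_rot e_opp e_iter co_k; set q := t ^+ k.
have q10 : 10.-primitive_root q by rewrite (prim_root_exp_coprime k t10).
exists q, q10; apply: map_iso_sym.
have q_neq1 : q != 1 by rewrite -[q]expr1 -(prim_order_dvd q10).
have qV_neq1 : q^-1 != 1 by rewrite invr_eq1.
pose b1 := r1 / (1 - q); pose b2 := r2 / (1 - q^-1).
have fix1 : r1 + q * b1 = b1 := affine_fixpoint r1 q_neq1.
have fix2 : r2 + q^-1 * b2 = b2 := affine_fixpoint r2 qV_neq1.
have a1_neq0 : l1 - b1 *+ 2 != 0.
  apply: (no_common_fixpoint (coord := fun z => z.1.1) bij_e e_rot e_opp _ _ _ fix1).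
  - by [].
  - by move=> [[x y] i0]; rewrite amul_half.
  - by move=> c; exists (c, 0, 0).
have a2_neq0 : l2 - b2 *+ 2 != 0.
  apply: (no_common_fixpoint (coord := fun z => z.1.2) bij_e e_rot e_opp _ _ _ fix2).
  - by [].
  - by move=> [[x y] i0]; rewrite amul_half.
  - by move=> c; exists (0, c, 0).
pose f (z : affine p) : affine p := ((l1 - b1 *+ 2) * z.1.1 + b1,
  (l2 - b2 *+ 2) * z.1.2 + b2, k * z.2).
have inj_f : injective f.
  move=> [[x y] j] [[x' y'] j'] /eqP; rewrite !xpair_eqE /=.
  case/andP=> /andP[/eqP/addIr/(mulfI a1_neq0)-> /eqP/addIr/(mulfI a2_neq0)->].
  move=> /eqP E; congr (_, _, _); apply: ord_inj; apply/eqP.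
  rewrite -(modn_small (ltn_ord j)) -(modn_small (ltn_ord j')).
  rewrite -(eq_prim_root_expr q10) /q -!exprM.
  have kE (i0 : 'Z_10) : t ^+ (k * i0)%N = t ^+ (k * i0)%R.
    by rewrite -(prim_expr_mod t10).
  by rewrite !kE E.
exists (e \o f); split=> [|z|z].
- by apply: inj_card_bij (inj_comp inj_e inj_f) _; rewrite (bij_eq_card bij_e).
- rewrite /= e_rot; congr (e _); case: z => [[x y] j].
  rewrite affine_rotE /f /amul -/q; congr (_, _, _).
  + by rewrite mulrDr addrCA fix1 mulrCA.
  + by rewrite mulrDr addrCA fix2 mulrCA.
  + by rewrite mulrDr mulr1 addrC.
- have k5 : k * 5%:R = 5%:R.
    apply: ord_inj; move: co_k; clear.
    by case: (k) => [[|[|[|[|[|[|[|[|[|[|]]]]]]]]]]].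
  have reflE (c b x : 'F_p) : (c - b *+ 2) * (1 - x) + b = c - ((c - b *+ 2) * x + b).
    set a := c - _; have ab : a + b = c - b by rewrite /a mulr2n opprD addrA subrK.
    by rewrite mulrBr mulr1 addrAC ab opprD addrA addrAC.
  rewrite /= e_opp; congr (e _); case: z => [[x y] j].
  rewrite affine_oppE /f amul_half //; congr (_, _, _); try exact: reflE.
  by rewrite mulrDr k5 addrC.
Qed.

End Classification.

(** * The two maps *)

Section TwoMaps.

Lemma map_iso_card_porbit (M N : oriented_map) : map_iso M N ->
  forall x, exists y, #|porbit (rot M) x| = #|porbit (rot N) y|.
Proof.
case=> f [[g fK gK] f_rot _] x; exists (f x).
have f_iter n : f (iter n (rot M) x) = iter n (rot N) (f x).
  by elim: n => //= n <-; rewrite f_rot.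
have dvdE n : (#|porbit (rot M) x| %| n)%N = (#|porbit (rot N) (f x)| %| n)%N.
  by rewrite !dvd_card_porbit -f_iter (inj_eq (can_inj fK)).
by apply/eqP; rewrite eqn_dvd dvdE dvdnn -dvdE dvdnn.
Qed.

Lemma prim10_opp (p : nat) (s : 'F_p) : prime p -> odd p ->
  5.-primitive_root s -> 10.-primitive_root (- s).
Proof.
move=> p_pr p_odd s5.
have sN5 : (- s) ^+ 5 = -1.
  by rewrite exprNn (prim_expr_order s5) mulr1 -signr_odd.
have two_neq0 : 2%:R != 0 :> 'F_p.
  by rewrite -unitfE unitFpE // coprimen2.
have sN10 : (- s) ^+ 10 = 1 by rewrite (exprM _ 5 2) sN5 sqrrN expr1n.
have [m sNm m10] := prim_order_exists (isT : (0 < 10)%N) sN10.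
have m5 : ~~ (m %| 5)%N.
  by rewrite (prim_order_dvd sNm) sN5 eq_sym -addr_eq0 -mulr2n.
have m2 : ~~ (m %| 2)%N.
  by rewrite (prim_order_dvd sNm) sqrrN -(prim_order_dvd s5).
have m_le : (m <= 10)%N by apply: dvdn_leq.
by move: m10 m5 m2 m_le sNm; do 11![case: m => [|m] //].
Qed.

Variables (p : nat) (s : 'F_p).
Hypotheses (p_pr : prime p) (s5 : 5.-primitive_root s).

Lemma affine_Ghat_map (t : 'F_p) (t10 : 10.-primitive_root t) :
  Ghat_map s 5 10 (affine_map t10).
Proof.
split; [exact: affine_regular | exact: euler_char_affine | | exact: isog_Ghat_affine].
by move=> z; split; [apply: affine_face_order | apply: affine_rot_order].
Qed.

Lemma affine_iso_either (t u : 'F_p) (t10 : 10.-primitive_root t)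
    (u10 : 10.-primitive_root u) :
  t = u \/ t = u^-1 -> map_iso (affine_map t10) (affine_map u10).
Proof.
case=> tu; last first.
  by subst t; apply/map_iso_sym/affine_iso_inv.
subst t; rewrite (bool_irrelevance t10 u10).
by exists id; split=> //; exists id.
Qed.

(** The primitive tenth roots of unity are [t], [t ^+ 3] and their inverses. *)
Lemma Ghat_map_classification (t : 'F_p) (t10 : 10.-primitive_root t)
    (t30 : 10.-primitive_root (t ^+ 3)) (M : oriented_map) :
    orientably_regular M -> (forall x, #|porbit (rot M) x| = 10%N) ->
    isog_Ghat s (autp M) ->
  map_iso M (affine_map t10) \/ map_iso M (affine_map t30).
Proof.
move=> regM rot10 isoM.
have [u [u10 iso_u]] := affine_classification p_pr s5 t10 regM rot10 isoM.
have [i u_i] := prim_rootP t10 (prim_expr_order u10).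
have co_i : coprime i 10 by rewrite -(prim_root_exp_coprime i t10) -u_i.
have t_inv j k : (j + k)%N = 10%N -> t ^+ j = t ^- k.
  move=> jk; apply: (mulIf (root_exp_neq0 t10 k)).
  by rewrite -exprD jk (prim_expr_order t10) mulVf ?root_exp_neq0.
have : (i : nat) \in [:: 1; 3; 7; 9]%N.
  by move: co_i; case: (i) => [[|[|[|[|[|[|[|[|[|[|]]]]]]]]]]].
rewrite !inE => /or4P[]/eqP iE; rewrite iE in u_i.
- left; apply: map_iso_trans iso_u _; apply: affine_iso_either; left.
  by rewrite u_i expr1.
- right; apply: map_iso_trans iso_u _; apply: affine_iso_either; left.
  exact: u_i.
- right; apply: map_iso_trans iso_u _; apply: affine_iso_either; right.
  by rewrite u_i; apply: t_inv.
- left; apply: map_iso_trans iso_u _; apply: affine_iso_either; right.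
  by rewrite u_i (t_inv 9%N 1%N).
Qed.

(** Equality of the traces at [t] and [t ^+ 3] would make
[(t ^+ 2 - 1) * (t ^+ 4 - 1)] vanish. *)
Lemma affine_cube_not_iso (t : 'F_p) (t10 : 10.-primitive_root t)
    (t30 : 10.-primitive_root (t ^+ 3)) :
  ~ map_iso (affine_map t10) (affine_map t30).
Proof.
move=> /affine_iso_trace trE; have t_neq0 := root_neq0 t10.
have : (t ^+ 2 - 1) * (t ^+ 4 - 1) = t ^+ 3 * ((t ^+ 3 + (t ^+ 3)^-1) - (t + t^-1)).
  by field.
rewrite -trE subrr mulr0 => /eqP.
by rewrite mulf_eq0 !subr_eq0 -!(prim_order_dvd t10).
Qed.

End TwoMaps.

Local Close Scope ring_scope.

Theorem corollaryC2 (p : nat) (hp : prime p) (hp11 : 11 <= p)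
    (hp5 : p = 1 %[mod 5]) (s : 'F_p) (hs : 5.-primitive_root%R s) :
  exists M1 M2 : oriented_map,
    [/\ Ghat_map s 5 10 M1,
        Ghat_map s 5 10 M2,
        ~ iso_up_to_dual M1 M2,
        (forall M : oriented_map, Ghat_map s 5 10 M \/ Ghat_map s 10 5 M ->
           iso_up_to_dual M M1 \/ iso_up_to_dual M M2)
      & reflexive_map M1 /\ reflexive_map M2].
Proof.
have p_odd : odd p by case: (even_prime hp) => // p2; rewrite p2 in hp11.
have t10 := prim10_opp hp p_odd hs.
have t30 : 10.-primitive_root%R ((- s) ^+ 3)%R.
  by rewrite (prim_root_exp_coprime 3 t10).
exists (affine_map t10), (affine_map t30); split.
- exact: affine_Ghat_map.
- exact: affine_Ghat_map.
- case=> [|/map_iso_card_porbit/(_ one_aff)[y]]; first exact: affine_cube_not_iso.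
  (* The vertices of the dual of the second map have degree 5. *)
  by rewrite /= affine_rot_order affine_face_order.
- move=> M [[regM _ typeM isoM] | [regM _ typeM isoM]].
    have rot10 x := (typeM x).2.
    by have [] := Ghat_map_classification hp hs t10 t30 regM rot10 isoM;
      [left; left | right; left].
  have regD : orientably_regular (dual M) by rewrite /orientably_regular autp_dual.
  have isoD : isog_Ghat s (autp (dual M)) by rewrite autp_dual.
  have rot10 x : #|porbit (rot (dual M)) x| = 10 := (typeM x).1.
  by have [] := Ghat_map_classification hp hs t10 t30 regD rot10 isoD;
      move=> /map_iso_dual; [left; right | right; right].
- split; exact: affine_reflexive.
Qed.
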